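(* Let $(A,A_r^* )$ be a quasi-triangular dendriform D-bialgebra induced by $r\in A\otimes A$. Then $r_+:(A^*,\prec_+,\succ_+)\to(A,\prec_A,\succ_A)$ is a relative Rota-Baxter operator of weight $1$ with respect to the action $(\mathcal{R}_A^*,-L_{\prec_A}^*,-R_{\succ_A}^*,\mathcal{L}_A^* )$ of $(A,\prec_A,\succ_A)$ on $(A^*,\prec_+,\succ_+)$.
   Context: All vector spaces are finite-dimensional over a field $\mathbb{K}$ of characteristic different from $2$. A dendriform algebra $(A,\prec_A,\succ_A)$ is a vector space with two bilinear products such that, with $x\ast y=x\prec_A y+x\succ_A y$, for all $x,y,z$: $(x\prec_A y)\prec_A z=x\prec_A(y\ast z)$, $(x\succ_A y)\prec_A z=x\succ_A(y\prec_A z)$, $x\succ_A(y\succ_A z)=(x\ast y)\succ_A z$. Put $L_{\succ_A}(x)y=x\succ_A y$, $L_{\prec_A}(x)y=x\prec_A y$, $R_{\succ_A}(x)y=y\succ_A x$, $R_{\prec_A}(x)y=y\prec_A x$, $\mathcal{L}_A=L_{\prec_A}+L_{\succ_A}$, $\mathcal{R}_A=R_{\prec_A}+R_{\succ_A}$. For $F:A\to\mathfrak{gl}(A)$ define $F^*:A\to\mathfrak{gl}(A^* )$ by $\langle F^*(x)\xi,y\rangle=\langle\xi,F(x)y\rangle$ (no sign). For $r=\sum_i a_i\otimes b_i\in A\otimes A$, define $r_+,r_-:A^*\to A$ by $r(\xi,\eta)=\langle r_+(\xi),\eta\rangle=\langle\xi,r_-(\eta)\rangle$, $I=r_+-r_-$;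 with the flip $\sigma$, the skew-symmetric part of $r$ is $a=\frac12(r-\sigma(r))$. An element $s\in A\otimes A$ is $(L_\succ,R_\prec)$-invariant if $(\mathrm{Id}\otimes\mathcal{L}_A(x)-R_{\prec_A}(x)\otimes\mathrm{Id})s=0$ and $(\mathrm{Id}\otimes L_{\succ_A}(x)-\mathcal{R}_A(x)\otimes\mathrm{Id})\sigma(s)=0$ for all $x\in A$. The D-equation for $r$ is $$\sum_{i,j}(a_i\ast a_j)\otimes b_i\otimes b_j-\sum_{i,j}a_i\otimes a_j\otimes(b_i\prec_A b_j)-\sum_{i,j}a_j\otimes(a_i\succ_A b_j)\otimes b_i=0.$$ If $r$ satisfies the D-equation and $a$ is $(L_\succ,R_\prec)$-invariant, then $A^*$ is a dendriform algebra, denoted $A_r^*=(A^*,\prec_r,\succ_r)$, with $\xi\succ_r\eta=\mathcal{R}_A^*(r_+(\xi))\eta-L_{\prec_A}^*(r_-(\eta))\xi$ and $\xi\prec_r\eta=\mathcal{L}_A^*(r_+(\eta))\xi-R_{\succ_A}^*(r_-(\xi))\eta$, and $(A,A_r^* )$ is a dendriform D-bialgebra, called the quasi-triangular dendriform D-bialgebra induced by $r$ (no further condition on $r$ is involved). In this situation $\prec_+,\succ_+$ are the products on $A^*$ given by $\xi\succ_+\eta=L_{\prec_A}^*(I\eta)\xi$, $\xi\prec_+\eta=R_{\succ_A}^*(I\xi)\eta$; $(A^*,\prec_+,\succ_+)$ is a dendriform algebra. Representation: $(V;l_\succ,r_\succ,l_\prec,r_\prec)$ with linear maps $l_\succ,r_\succ,l_\prec,r_\prec:A\to\mathfrak{gl}(V)$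 is a representation of $(A,\prec_A,\succ_A)$ if $A\oplus V$ with $(x+u)\succ(y+v)=x\succ_A y+l_\succ(x)v+r_\succ(y)u$, $(x+u)\prec(y+v)=x\prec_A y+l_\prec(x)v+r_\prec(y)u$ is a dendriform algebra. Action of $(A,\prec_A,\succ_A)$ on a dendriform algebra $(B,\prec_B,\succ_B)$: a quadruple $(l_\succ,r_\succ,l_\prec,r_\prec)$ such that $(B;l_\succ,r_\succ,l_\prec,r_\prec)$ is a representation of $A$ and, with $l_\ast=l_\prec+l_\succ$, $r_\ast=r_\prec+r_\succ$, $u\ast_B v=u\prec_B v+u\succ_B v$, for all $x\in A$, $u,v\in B$: $r_\prec(x)(u\succ_B v)=u\succ_B(r_\prec(x)v)$; $(l_\succ(x)u)\prec_B v=l_\succ(x)(u\prec_B v)$; $(r_\succ(x)u)\prec_B v=u\succ_B(l_\prec(x)v)$; $r_\prec(x)(u\prec_B v)=u\prec_B(r_\ast(x)v)$; $(l_\prec(x)u)\prec_B v=l_\prec(x)(u\ast_B v)$; $(r_\prec(x)u)\prec_B v=u\prec_B(l_\ast(x)v)$; $l_\succ(x)(u\succ_B v)=(l_\ast(x)u)\succ_B v$; $u\succ_B(l_\succ(x)v)=(r_\ast(x)u)\succ_B v$; $u\succ_B(r_\succ(x)v)=r_\succ(x)(u\ast_B v)$. Relative Rota-Baxter operator of weight $\lambda$ with respect to such an action: a linear map $T:B\to A$ with, for all $u,v\in B$, $(Tu)\succ_A(Tv)=T(l_\succ(Tu)v+r_\succ(Tv)u+\lambda\,u\succ_B v)$ and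 $(Tu)\prec_A(Tv)=T(l_\prec(Tu)v+r_\prec(Tv)u+\lambda\,u\prec_B v)$. *)

(* Defs.v *)
From HB Require Import structures.
From mathcomp Require Import all_boot all_order all_algebra.

Set Implicit Arguments.
Unset Strict Implicit.
Unset Printing Implicit Defensive.

Import GRing.Theory.
Local Open Scope ring_scope.

(* The library has no tensor product of vector spaces: U (x) V is modelled by
   the coordinate matrices in the bases vbasis {:U} and vbasis {:V}.  The lemmas
   tens_bilinear, tensor_decomp and tliftE below give the bilinearity of (x),
   the generation by pure tensors and the universal property; nothing else about
   the model matters. *)
Section Tensor.
Variable K : fieldType.

Definition tensor (U V : vectType K) := 'M[K]_(\dim {:U}, \dim {:V}).

Definition tens (U V : vectType K) (u : U) (v : V) : tensor U V :=
  \matrix_(i, j) (coord (vbasis {:U}) i u * coord (vbasis {:V}) j v).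

(* The linear map U (x) V -> W induced by a bilinear f : U -> V -> W *)
Definition tlift (U V W : vectType K) (f : U -> V -> W) (t : tensor U V) : W :=
  \sum_i \sum_j t i j *: f (vbasis {:U})`_i (vbasis {:V})`_j.

Definition tmap (U V U' V' : vectType K) (f : 'Hom(U, U')) (g : 'Hom(V, V')) :
    tensor U V -> tensor U' V' :=
  tlift (fun u v => tens (f u) (g v)).

Definition flip (U V : vectType K) : tensor U V -> tensor V U :=
  tlift (fun u v => tens v u).

Definition bilinear_fun (U V W : vectType K) (f : U -> V -> W) : Prop :=
  (forall u, linear (f u)) /\ (forall v, linear (f^~ v)).

Section Facts.
Variables U V W : vectType K.
Implicit Types (u : U) (v : V) (t : tensor U V).

Lemma tens_bilinear : bilinear_fun (@tens U V).
Proof.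
split=> [u c v v' | v c u u']; apply/matrixP=> i j; rewrite !mxE linearP /=.
  by rewrite mulrDr mulrCA.
by rewrite mulrDl mulrA.
Qed.

Lemma tensor_basis t :
  t = \sum_i \sum_j t i j *: tens (vbasis {:U})`_i (vbasis {:V})`_j.
Proof.
have fU := basis_free (vbasisP {:U}); have fV := basis_free (vbasisP {:V}).
apply/matrixP=> p q; rewrite summxE (bigD1 p) //= summxE (bigD1 q) //=.
rewrite !mxE !coord_free // !eqxx !mulr1 big1 ?addr0 => [|j /negPf jq]; last first.
  by rewrite !mxE !coord_free // jq !mulr0.
rewrite big1 ?addr0 // => i /negPf ip; rewrite summxE big1 // => j _.
by rewrite !mxE !coord_free // ip mul0r mulr0.
Qed.

Lemma tlift_linear (f : U -> V -> W) : linear (tlift f).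
Proof.
move=> c s t; rewrite /tlift scaler_sumr -big_split; apply: eq_bigr => i _ /=.
rewrite scaler_sumr -big_split; apply: eq_bigr => j _ /=.
by rewrite !mxE scalerDl scalerA.
Qed.

Lemma tlift0 (f : U -> V -> W) : tlift f 0 = 0.
Proof. by rewrite /tlift big1 // => i _; rewrite big1 // => j _; rewrite mxE scale0r. Qed.

Lemma tlift_sum (f : U -> V -> W) I (s : seq I) (P : pred I) F :
  tlift f (\sum_(i <- s | P i) F i) = \sum_(i <- s | P i) tlift f (F i).
Proof.
elim/big_rec2: _ => [|i x y _ <-]; first exact: tlift0.
by have := tlift_linear f 1 (F i) y; rewrite !scale1r.
Qed.

Lemma tliftE (f : U -> V -> W) : bilinear_fun f ->
  forall u v, tlift f (tens u v) = f u v.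
Proof.
move=> [fr fl] u v.
have fDl (I : finType) (c : I -> K) (x : I -> U) w :
    f (\sum_i c i *: x i) w = \sum_i c i *: f (x i) w.
  pose g := HB.pack_for {linear U -> W} (f^~ w)
    (GRing.isLinear.Build _ _ _ _ _ (fl w)).
  by rewrite -[LHS]/(g _) linear_sum; apply: eq_bigr => i _; rewrite linearZ.
have fDr (I : finType) (c : I -> K) (x : I -> V) w :
    f w (\sum_i c i *: x i) = \sum_i c i *: f w (x i).
  pose g := HB.pack_for {linear V -> W} (f w)
    (GRing.isLinear.Build _ _ _ _ _ (fr w)).
  by rewrite -[LHS]/(g _) linear_sum; apply: eq_bigr => i _; rewrite linearZ.
rewrite {2}(coord_vbasis (memvf u)) fDl; apply: eq_bigr => i _.
rewrite {2}(coord_vbasis (memvf v)) fDr scaler_sumr; apply: eq_bigr => j _.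
by rewrite mxE scalerA.
Qed.

Lemma tensor_decomp t :
  exists (n : nat) (a : 'I_n -> U) (b : 'I_n -> V), t = \sum_i tens (a i) (b i).
Proof.
pose I : finType := ('I_(\dim {:U}) * 'I_(\dim {:V}))%type.
pose a (k : 'I_#|I|) := (vbasis {:U})`_(enum_val k).1.
pose b (k : 'I_#|I|) :=
  t (enum_val k).1 (enum_val k).2 *: (vbasis {:V})`_(enum_val k).2.
exists #|I|, a, b; rewrite {1}[t]tensor_basis pair_big /=.
rewrite (reindex_onto (@enum_val I I) enum_rank) /=; last first.
  by move=> k _; rewrite enum_rankK.
apply: eq_big => [k | k _]; first by rewrite enum_valK eqxx.
by apply/matrixP=> i j; rewrite !mxE linearZ /= mulrCA.
Qed.

End Facts.

Lemma tmapE (U V U' V' : vectType K) (f : 'Hom(U, U')) (g : 'Hom(V, V')) u v :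
  tmap f g (tens u v) = tens (f u) (g v).
Proof.
rewrite /tmap tliftE //; split=> [x c y z | y c x z]; rewrite linearP.
  by rewrite (tens_bilinear U' V').1.
by rewrite (tens_bilinear U' V').2.
Qed.

Lemma flipE (U V : vectType K) (u : U) (v : V) :
  flip (tens u v) = tens v u.
Proof.
rewrite /flip tliftE //; split=> [x c y z | y c x z].
  by rewrite (tens_bilinear V U).2.
by rewrite (tens_bilinear V U).1.
Qed.

End Tensor.

Notation dual K A := 'Hom(A, K^o).

Section Dendriform.
Variable K : fieldType.

(* Bilinear products A x A -> B and linear maps A -> gl(V) are both elements of
   'Hom(_, 'Hom(_, _)); in particular a product is its own left multiplication. *)
Definition bilin (U V W : vectType K) (f : U -> V -> W) : 'Hom(U, 'Hom(V, W)) :=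
  linfun (fun u => linfun (f u)).

Lemma linfunE (U V : vectType K) (f : U -> V) : linear f -> linfun f =1 f.
Proof.
move=> L; pose g := HB.pack_for {linear U -> V} f
  (GRing.isLinear.Build _ _ _ _ f L).
exact: (lfunE g).
Qed.

Lemma bilinE (U V W : vectType K) (f : U -> V -> W) : bilinear_fun f ->
  forall u v, bilin f u v = f u v.
Proof.
move=> [fr fl] u v.
have L : linear (fun u => linfun (f u)).
  by move=> c x y; apply/lfunP=> w; rewrite !lfun_simp !linfunE //; exact: fl.
by rewrite /bilin (linfunE L) linfunE.
Qed.

Definition product (A : vectType K) := 'Hom(A, 'End(A)).

Definition is_dendriform (A : vectType K) (prec succ : product A) : Prop :=
  [/\ forall x y z, prec (prec x y) z = prec x (prec y z + succ y z),
      forall x y z, prec (succ x y) z = succ x (prec y z)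
    & forall x y z, succ x (succ y z) = succ (prec x y + succ x y) z].

(* Right multiplication: rmul m x y = m y x *)
Definition rmul (A : vectType K) (m : product A) : product A :=
  bilin (fun x y => m y x).

Lemma rmulE (A : vectType K) (m : product A) x y : rmul m x y = m y x.
Proof.
rewrite bilinE //; split=> [u c v v' | v c u u']; last by rewrite linearP.
by rewrite linearP !lfun_simp.
Qed.

(* <F^*(x) xi, y> = <xi, F(x) y>, without sign *)
Definition dualmap (A : vectType K) (F : 'Hom(A, 'End(A))) :
    'Hom(A, 'End(dual K A)) :=
  bilin (fun (x : A) (xi : dual K A) => (xi \o F x)%VF).

Lemma dualmapE (A : vectType K) (F : 'Hom(A, 'End(A))) x (xi : dual K A) y :
  dualmap F x xi y = xi (F x y).
Proof.
rewrite bilinE ?comp_lfunE //; split=> [u c v v' | v c u u']; apply/lfunP=> z.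
  by rewrite !lfun_simp.
by rewrite !(linearP, lfun_simp).
Qed.

Definition semidirect_succ (A V : vectType K) (succ : product A)
    (ls rs : 'Hom(A, 'End(V))) : product (A * V)%type :=
  bilin (fun p q : A * V => (succ p.1 q.1, ls p.1 q.2 + rs q.1 p.2)).

Definition semidirect_prec (A V : vectType K) (prec : product A)
    (lp rp : 'Hom(A, 'End(V))) : product (A * V)%type :=
  bilin (fun p q : A * V => (prec p.1 q.1, lp p.1 q.2 + rp q.1 p.2)).

Lemma semidirect_succE (A V : vectType K) (succ : product A) ls rs
    (p q : A * V) :
  semidirect_succ succ ls rs p q = (succ p.1 q.1, ls p.1 q.2 + rs q.1 p.2).
Proof.
rewrite bilinE //; split=> [u c v v' | v c u u'];
  rewrite /= !(linearP, lfun_simp) /=;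
  apply/eqP; rewrite xpair_eqE; apply/andP; split; apply/eqP; rewrite //=.
  by rewrite scalerDr addrACA.
by rewrite scalerDr addrACA.
Qed.

Lemma semidirect_precE (A V : vectType K) (prec : product A) lp rp
    (p q : A * V) :
  semidirect_prec prec lp rp p q = (prec p.1 q.1, lp p.1 q.2 + rp q.1 p.2).
Proof. exact: semidirect_succE. Qed.

(* Quadruples are ordered (l_succ, r_succ, l_prec, r_prec). *)
Definition is_representation (A : vectType K) (prec succ : product A)
    (V : vectType K) (ls rs lp rp : 'Hom(A, 'End(V))) : Prop :=
  is_dendriform (semidirect_prec prec lp rp) (semidirect_succ succ ls rs).

Record is_action (A : vectType K) (precA succA : product A)
    (B : vectType K) (precB succB : product B)
    (ls rs lp rp : 'Hom(A, 'End(B))) : Prop := IsAction {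
  action_dendA : is_dendriform precA succA;
  action_dendB : is_dendriform precB succB;
  action_rep : is_representation precA succA ls rs lp rp;
  action1 : forall x u v, rp x (succB u v) = succB u (rp x v);
  action2 : forall x u v, precB (ls x u) v = ls x (precB u v);
  action3 : forall x u v, precB (rs x u) v = succB u (lp x v);
  action4 : forall x u v, rp x (precB u v) = precB u (rp x v + rs x v);
  action5 : forall x u v, precB (lp x u) v = lp x (precB u v + succB u v);
  action6 : forall x u v, precB (rp x u) v = precB u (lp x v + ls x v);
  action7 : forall x u v, ls x (succB u v) = succB (lp x u + ls x u) v;
  action8 : forall x u v, succB u (ls x v) = succB (rp x u + rs x u) v;
  action9 : forall x u v, succB u (rs x v) = rs x (precB u v + succB u v)
}.

Definition is_relative_rota_baxter (lambda : K)
    (A : vectType K) (precA succA : product A)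
    (B : vectType K) (precB succB : product B)
    (ls rs lp rp : 'Hom(A, 'End(B))) (T : 'Hom(B, A)) : Prop :=
  [/\ is_action precA succA precB succB ls rs lp rp,
      forall u v, succA (T u) (T v) =
        T (ls (T u) v + rs (T v) u + lambda *: succB u v)
    & forall u v, precA (T u) (T v) =
        T (lp (T u) v + rp (T v) u + lambda *: precB u v)].

Section RMatrix.
Variables (A : vectType K) (prec succ : product A).
Implicit Types (r s : tensor A A) (xi eta : dual K A).

(* r(xi, eta), with (a (x) b)(xi, eta) = <xi, a> <eta, b> *)
Definition teval r xi eta : K^o := tlift (fun a b => xi a * eta b : K^o) r.

Definition rplus r : 'Hom(dual K A, A) :=
  linfun (fun xi : dual K A => tlift (fun a b => xi a *: b) r).

Definition rminus r : 'Hom(dual K A, A) :=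
  linfun (fun eta : dual K A => tlift (fun a b => eta b *: a) r).

Lemma rplusE r xi eta : eta (rplus r xi) = teval r xi eta.
Proof.
have L : linear (fun xi : dual K A => tlift (fun a b => xi a *: b) r).
  move=> c f g; rewrite /tlift scaler_sumr -big_split; apply: eq_bigr => i _ /=.
  rewrite scaler_sumr -big_split; apply: eq_bigr => j _ /=.
  rewrite add_lfunE scale_lfunE scalerDl scalerDr; congr (_ + _).
  by rewrite !scalerA; congr (_ *: _); rewrite mulrCA mulrA.
rewrite /rplus (linfunE L) /tlift linear_sum; apply: eq_bigr => i _.
rewrite linear_sum; apply: eq_bigr => j _; rewrite !linearZ /=.
by rewrite !scalerA mulrC.
Qed.

Lemma rminusE r xi eta : xi (rminus r eta) = teval r xi eta.
Proof.
have L : linear (fun xi : dual K A => tlift (fun a b => xi b *: a) r).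
  move=> c f g; rewrite /tlift scaler_sumr -big_split; apply: eq_bigr => i _ /=.
  rewrite scaler_sumr -big_split; apply: eq_bigr => j _ /=.
  rewrite add_lfunE scale_lfunE scalerDl scalerDr; congr (_ + _).
  by rewrite !scalerA; congr (_ *: _); rewrite mulrCA mulrA.
rewrite /rminus (linfunE L) /tlift linear_sum; apply: eq_bigr => i _.
rewrite linear_sum; apply: eq_bigr => j _; rewrite linearZ linearZ /=.
by congr (_ *: _); apply: mulrC.
Qed.

Definition Imap r : 'Hom(dual K A, A) := rplus r - rminus r.

Definition skew_part r : tensor A A := 2%:R^-1 *: (r - flip r).

Definition is_LR_invariant s : Prop := forall x : A,
  tmap \1%VF (prec x + succ x) s - tmap (rmul prec x) \1%VF s = 0 /\
  tmap \1%VF (succ x) (flip s)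
    - tmap (rmul prec x + rmul succ x) \1%VF (flip s) = 0.

Definition D_expr n (a b : 'I_n -> A) : tensor A (tensor A A) :=
  \sum_i \sum_j tens (prec (a i) (a j) + succ (a i) (a j)) (tens (b i) (b j))
  - \sum_i \sum_j tens (a i) (tens (a j) (prec (b i) (b j)))
  - \sum_i \sum_j tens (a j) (tens (succ (a i) (b j)) (b i)).

(* By D_equationP the choice of the decomposition of r is irrelevant. *)
Definition D_equation r : Prop :=
  exists (n : nat) (a b : 'I_n -> A),
    r = \sum_i tens (a i) (b i) /\ D_expr a b = 0.

Lemma D_equationP r n (a b : 'I_n -> A) : r = \sum_i tens (a i) (b i) ->
  D_equation r <-> D_expr a b = 0.
Proof.
pose F (a b a' b' : A) : tensor A (tensor A A) :=
  tens (prec a a' + succ a a') (tens b b') - tens a (tens a' (prec b b'))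
  - tens a' (tens (succ a b') b).
have linB (U V : vectType K) (f g : U -> V) :
    linear f -> linear g -> linear (fun z => f z - g z).
  by move=> lf lg c u v; rewrite lf lg opprD addrACA scalerBr.
have linD (U V : vectType K) (f g : U -> V) :
    linear f -> linear g -> linear (fun z => f z + g z).
  by move=> lf lg c u v; rewrite lf lg addrACA scalerDr.
have linTl (U V W : vectType K) (f : U -> V) (w : W) :
    linear f -> linear (fun zz => tens (f zz) w).
  by move=> lf c u v; rewrite lf (tens_bilinear V W).2.
have linTr (U V W : vectType K) (f : U -> V) (w : W) :
    linear f -> linear (fun zz => tens w (f zz)).
  by move=> lf c u v; rewrite lf (tens_bilinear W V).1.
have linm (m : product A) x : linear (m x) by move=> c u v; rewrite linearP.
have linm' (m : product A) x : linear (m^~ x).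
  by move=> c u v; rewrite linearP !lfun_simp.
have idl : linear (@id A) by [].
have B1 x y : bilinear_fun (F x y).
  split=> z; rewrite /F; repeat (exact idl || exact (linm _ _)
    || exact (linm' _ _) ||
    lazymatch goal with |- GRing.linear_for _ ?h => match h with
    | fun zz => @?f zz - @?g zz => refine (linB _ _ f g _ _)
    | fun zz => @?f zz + @?g zz => refine (linD _ _ f g _ _)
    | fun zz => tens ?w (@?f zz) => refine (linTr _ _ _ f w _)
    | fun zz => tens (@?f zz) ?w => refine (linTl _ _ _ f w _)
    | tens ?w => exact (linTr _ _ _ id w idl)
    | fun zz => tens zz ?w => exact (linTl _ _ _ id w idl)
    end end).
have B2 x y : bilinear_fun (fun z w => F z w x y).
  split=> z; rewrite /F; repeat (exact idl || exact (linm _ _)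
    || exact (linm' _ _) ||
    lazymatch goal with |- GRing.linear_for _ ?h => match h with
    | fun zz => @?f zz - @?g zz => refine (linB _ _ f g _ _)
    | fun zz => @?f zz + @?g zz => refine (linD _ _ f g _ _)
    | fun zz => tens ?w (@?f zz) => refine (linTr _ _ _ f w _)
    | fun zz => tens (@?f zz) ?w => refine (linTl _ _ _ f w _)
    | tens ?w => exact (linTr _ _ _ id w idl)
    | fun zz => tens zz ?w => exact (linTl _ _ _ id w idl)
    end end).
pose G x y := tlift (F x y) r.
have B : bilinear_fun G.
  split=> [x c y y' | y c x x']; rewrite /G /tlift scaler_sumr -big_split /=;
    apply: eq_bigr => i _; rewrite scaler_sumr -big_split /=;
    apply: eq_bigr => j _; rewrite ((B2 _ _).1, (B2 _ _).2) scalerDr !scalerA;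
    by rewrite mulrC.
have E m (a' b' : 'I_m -> A) : r = \sum_i tens (a' i) (b' i) ->
    D_expr a' b' = tlift G r.
  move=> Er; rewrite [in RHS]Er tlift_sum /D_expr -!sumrB.
  apply: eq_bigr => i _.
  rewrite (tliftE B) /G Er tlift_sum -!sumrB; apply: eq_bigr => j _.
  by rewrite (tliftE (B1 _ _)).
move=> Er; split=> [[m [a' [b' [Er' D0]]]] | D0]; last by exists n, a, b.
by rewrite (E _ _ _ Er) -(E _ _ _ Er').
Qed.

(* The standing hypothesis that r induces a quasi-triangular dendriform
   D-bialgebra: its coproduct is then determined by r. *)
Definition is_quasi_triangular r : Prop :=
  D_equation r /\ is_LR_invariant (skew_part r).

(* xi prec_+ eta = R_succ^*(I xi) eta,  xi succ_+ eta = L_prec^*(I eta) xi *)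
Definition prec_plus r : product (dual K A) :=
  (dualmap (rmul succ) \o Imap r)%VF.

Definition succ_plus r : product (dual K A) :=
  rmul (dualmap prec \o Imap r)%VF.

Lemma prec_plusE r xi eta :
  prec_plus r xi eta = dualmap (rmul succ) (Imap r xi) eta.
Proof. by rewrite comp_lfunE. Qed.

Lemma succ_plusE r xi eta :
  succ_plus r xi eta = dualmap prec (Imap r eta) xi.
Proof. by rewrite rmulE comp_lfunE. Qed.

End RMatrix.
End Dendriform.

(* Main.v *)
(** Write [I] for [r_+ - r_-] and [<xi, x>] for the pairing.  Invariance of the
    skew-symmetric part of [r] makes [I] intertwine the dual representation of
    [A] with the regular one, and together with the skew-symmetry of [I] it turns
    both products of the dual into minus a left action through [I]; every action
    law is then one of the nine representation laws.  The D-equation reads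
      [<xi, r_- eta * r_- zeta>
         = <zeta, r_+ xi prec r_+ eta> + <eta, r_- zeta succ r_+ xi>],
    and each Rota-Baxter identity paired with [zeta] is an instance of it up to
    terms in [I], which cancel by invariance. *)
Require Import Defs.
From HB Require Import structures.
From mathcomp Require Import all_boot all_order all_algebra.

Set Implicit Arguments.
Unset Strict Implicit.
Unset Printing Implicit Defensive.

Import GRing.Theory.
Local Open Scope ring_scope.

(** * Representations and actions of a dendriform algebra *)

Section Representations.
Variables (K : fieldType) (A V : vectType K) (prec succ : product A).
Variables ls rs lp rp : 'Hom(A, 'End(V)).

(** The semidirect product on [A * V] obeys each of the three axioms iff it does so with the vector
    of [V] in first, second and third position: nine laws, listed axiom by axiom in this order. *)
Record representation_laws : Prop := RepresentationLaws {
  rep_rprp : forall y z u, rp z (rp y u) = rp (prec y z + succ y z) u;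
  rep_rplp : forall x z u, rp z (lp x u) = lp x (rp z u + rs z u);
  rep_lp : forall x y u, lp (prec x y) u = lp x (lp y u + ls y u);
  rep_rprs : forall y z u, rp z (rs y u) = rs (prec y z) u;
  rep_rpls : forall x z u, rp z (ls x u) = ls x (rp z u);
  rep_lpsucc : forall x y u, lp (succ x y) u = ls x (lp y u);
  rep_rssucc : forall y z u, rs (succ y z) u = rs z (rp y u + rs y u);
  rep_lsrs : forall x z u, ls x (rs z u) = rs z (lp x u + ls x u);
  rep_lsls : forall x y u, ls x (ls y u) = ls (prec x y + succ x y) u
}.

Hypothesis dendA : is_dendriform prec succ.
Hypothesis laws : representation_laws.

Lemma representation_of_laws : is_representation prec succ ls rs lp rp.
Proof.
case: dendA => dpp dsp dss; case: laws => l1 l2 l3 l4 l5 l6 l7 l8 l9.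
split=> -[x u] [y v] [z w]; rewrite !(semidirect_precE, semidirect_succE) /=.
- rewrite dpp l3 [rp z (_ + _)]linearD /= l1 l2 addrA -linearD /=.
  by congr (_, lp x _ + _); rewrite addrACA.
- by rewrite dsp l6 linearD /= l4 l5 [ls x (_ + _)]linearD /= addrA.
rewrite dss [ls x (_ + _)]linearD /= l9 l8 l7 -addrA -linearD /=.
by congr (_, _ + rs z _); rewrite addrACA.
Qed.

Variables (precV succV : product V) (I : 'Hom(V, A)).
Hypothesis I_ls : forall x u, I (ls x u) = succ x (I u).
Hypothesis I_rs : forall x u, I (rs x u) = succ (I u) x.
Hypothesis I_lp : forall x u, I (lp x u) = prec x (I u).
Hypothesis I_rp : forall x u, I (rp x u) = prec (I u) x.
Hypothesis precVE : forall u v, precV u v = - lp (I u) v.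
Hypothesis succVE : forall u v, succV u v = - ls (I u) v.

(** The hypotheses make [- I] a morphism from [V] to [A], and both products on [V] the left actions
    pulled back along it. *)
Lemma action_of_intertwiner : is_action prec succ precV succV ls rs lp rp.
Proof.
have IDp x u : I (lp x u + ls x u) = prec x (I u) + succ x (I u).
  by rewrite linearD /= I_lp I_ls.
have IDr x u : I (rp x u + rs x u) = prec (I u) x + succ (I u) x.
  by rewrite linearD /= I_rp I_rs.
have sumV u v : precV u v + succV u v = - (lp (I u) v + ls (I u) v).
  by rewrite precVE succVE opprD.
have NN (F : 'Hom(A, 'End(V))) x v : F (- x) v = - F x v.
  by rewrite linearN opp_lfunE.
case: (laws) => l1 l2 l3 l4 l5 l6 l7 l8 l9; split=> //.
(* The axioms of [V] are the laws with the vector last, taken at [I u] and [I v]. *)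
- split=> u v w.
  + by rewrite sumV !precVE !linearN /= I_lp opp_lfunE l3.
  + by rewrite !precVE !succVE !linearN /= I_ls opp_lfunE l6.
  + by rewrite sumV !succVE !linearN /= IDp opp_lfunE l9.
- exact: representation_of_laws.
- by move=> x u v; rewrite !succVE linearN /= l5.
- by move=> x u v; rewrite !precVE I_ls l6 linearN.
- by move=> x u v; rewrite precVE succVE I_rs l6.
- by move=> x u v; rewrite !precVE linearN /= l2.
- by move=> x u v; rewrite sumV precVE I_lp l3 linearN.
- by move=> x u v; rewrite !precVE I_rp l3.
- by move=> x u v; rewrite !succVE IDp linearN /= l9.
- by move=> x u v; rewrite !succVE IDr l9.
by move=> x u v; rewrite sumV !succVE linearN /= l8.
Qed.

End Representations.

(** * The dual representation and the pairing of tensors with covectors *)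

Section Dual.
Variables (K : fieldType) (A : vectType K).
Implicit Types (x y : A) (xi eta zeta : dual K A) (r s : tensor A A).

Lemma dual_separates x y : (forall zeta, zeta x = zeta y) -> x = y.
Proof.
move=> E; rewrite (coord_vbasis (memvf x)) (coord_vbasis (memvf y)).
apply: eq_bigr => i _; congr (_ *: _).
have L : linear (coord (vbasis {:A}) i : A -> K^o) by move=> c u v; rewrite linearP.
by have := E (linfun (coord (vbasis {:A}) i : A -> K^o)); rewrite !(linfunE L).
Qed.

Lemma dualmapDE (m m' : product A) x xi y :
  dualmap (m + m') x xi y = xi (m x y) + xi (m' x y).
Proof. by rewrite dualmapE !add_lfunE linearD. Qed.

Lemma dualmap_rmulDE (m m' : product A) x xi y :
  dualmap (rmul m + rmul m') x xi y = xi (m y x) + xi (m' y x).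
Proof. by rewrite dualmapDE !rmulE. Qed.

(** Transposition reverses composition, so each law evaluated at a vector is a covector applied to a
    dendriform axiom or to an associativity. The signs make [rp + rs] the transpose of left [succ],
    and [lp + ls] that of right [prec]. *)
Lemma dualmap_representation (prec succ : product A) :
  is_dendriform prec succ ->
  representation_laws prec succ
    (dualmap (rmul prec + rmul succ)) (- dualmap prec)
    (- dualmap (rmul succ)) (dualmap (prec + succ)).
Proof.
move=> [dpp dsp dss].
(* Adding the three axioms shows that [prec + succ] is associative. *)
have starA x y z : prec (prec x y + succ x y) z + succ (prec x y + succ x y) z =
    prec x (prec y z + succ y z) + succ x (prec y z + succ y z).
  by rewrite linearD add_lfunE dpp dsp -dss -addrA -linearD.
(* With variables for the four maps, rewriting does not unfold [dualmap]. *)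
have gen (ls rs lp rp : 'Hom(A, 'End(dual K A))) :
    (forall x xi y, ls x xi y = xi (prec y x + succ y x)) ->
    (forall x xi y, rs x xi y = - xi (prec x y)) ->
    (forall x xi y, lp x xi y = - xi (succ y x)) ->
    (forall x xi y, rp x xi y = xi (prec x y + succ x y)) ->
    representation_laws prec succ ls rs lp rp.
  move=> lsE rsE lpE rpE; split=> x y xi; apply/lfunP=> z.
  - by rewrite !rpE starA.
  - by rewrite rpE !lpE add_lfunE rpE rsE [xi (_ + _)]linearD addrAC subrr add0r dss.
  - by rewrite !lpE add_lfunE lpE lsE [xi (_ + _)]linearD [- _ + _]addrC addrK dsp.
  - by rewrite rpE !rsE dpp.
  - by rewrite rpE !lsE rpE starA.
  - by rewrite lsE !lpE dss.
  - by rewrite !rsE add_lfunE rpE rsE [xi (_ + _)]linearD addrAC subrr add0r dsp.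
  - by rewrite lsE !rsE add_lfunE lpE lsE [xi (_ + _)]linearD [- _ + _]addrC addrK dpp.
  by rewrite !lsE starA.
apply: gen => x xi y.
- by rewrite dualmap_rmulDE linearD.
- by rewrite !opp_lfunE dualmapE.
- by rewrite !opp_lfunE dualmapE rmulE.
by rewrite dualmapDE linearD.
Qed.

Lemma teval_tens xi eta x y : teval (tens x y) xi eta = xi x * eta y.
Proof.
rewrite /teval tliftE //; split=> [u c v v' | v c u u'].
  by rewrite linearP mulrDr mulrCA.
by rewrite linearP mulrDl -scalerAl.
Qed.

Lemma tevalB r s xi eta : teval (r - s) xi eta = teval r xi eta - teval s xi eta.
Proof.
have := tlift_linear (fun a b => xi a * eta b : K^o) (- 1) s r.
by rewrite !scaleN1r [- s + r]addrC => /= E; rewrite /teval E addrC.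
Qed.

Lemma tevalZ c r xi eta : teval (c *: r) xi eta = c * teval r xi eta.
Proof.
have := tlift_linear (fun a b => xi a * eta b : K^o) c r 0.
by rewrite tlift0 !addr0.
Qed.

Lemma teval_tmap (f g : 'End(A)) r xi eta :
  teval (tmap f g r) xi eta = teval r (xi \o f)%VF (eta \o g)%VF.
Proof.
have [n [a [b ->]]] := tensor_decomp r.
rewrite /tmap tlift_sum /teval !tlift_sum; apply: eq_bigr => i _.
by rewrite -/(tmap f g _) -!/(teval _ _ _) tmapE !teval_tens !comp_lfunE.
Qed.

Lemma teval_flip r xi eta : teval (flip r) xi eta = teval r eta xi.
Proof.
have [n [a [b ->]]] := tensor_decomp r.
rewrite /flip tlift_sum /teval !tlift_sum; apply: eq_bigr => i _.
by rewrite -/(flip _) -!/(teval _ _ _) flipE !teval_tens mulrC.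
Qed.

Lemma ImapE r xi eta : eta (Imap r xi) = teval r xi eta - teval r eta xi.
Proof. by rewrite add_lfunE opp_lfunE linearB /= rplusE rminusE. Qed.

Lemma Imap_skew r xi eta : eta (Imap r xi) = - xi (Imap r eta).
Proof. by rewrite !ImapE opprB. Qed.

(** * Invariance of the skew-symmetric part and the resulting action *)

Section Invariant.
Variables (prec succ : product A) (r : tensor A A).
Hypothesis charK : 2%N \notin [pchar K].
Hypothesis invr : is_LR_invariant prec succ (skew_part r).

(** The characteristic enters here, to cancel the one half in [skew_part]. *)
Lemma Imap_skew_part xi eta : eta (Imap r xi) = 2%:R * teval (skew_part r) xi eta.
Proof.
have two_neq0 : 2%:R != 0 :> K by move: charK; rewrite inE.
by rewrite tevalZ tevalB teval_flip mulVKf // ImapE.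
Qed.

Lemma invariant_prec_succ x xi eta :
  eta (prec x (Imap r xi)) + eta (succ x (Imap r xi)) = - xi (prec (Imap r eta) x).
Proof.
have /(congr1 (fun s => 2%:R * teval s xi eta)) /= := (invr x).1.
rewrite tevalB [teval 0 _ _]tlift0 !teval_tmap mulr0 mulrBr -!Imap_skew_part.
move/eqP; rewrite subr_eq0 => /eqP.
rewrite !comp_lfun1r !comp_lfunE add_lfunE linearD /= => ->.
by rewrite Imap_skew comp_lfunE rmulE.
Qed.

Lemma invariant_succ x xi eta :
  eta (succ x (Imap r xi)) = - (xi (prec (Imap r eta) x) + xi (succ (Imap r eta) x)).
Proof.
have /(congr1 (fun s => 2%:R * teval s xi eta)) /= := (invr x).2.
rewrite tevalB [teval 0 _ _]tlift0 !teval_tmap !teval_flip mulr0 mulrBr.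
rewrite -!Imap_skew_part => /eqP; rewrite subr_eq0 => /eqP.
rewrite !comp_lfun1r Imap_skew !comp_lfunE [(rmul _ _ + _)%R _]add_lfunE.
rewrite !rmulE linearD /=.
by move/(canRL opprK).
Qed.

(** The difference of the two preceding identities, which are the two halves of the invariance
    paired with [xi] and [eta]. *)
Lemma invariant_prec x xi eta :
  eta (prec x (Imap r xi)) = xi (succ (Imap r eta) x).
Proof.
have := invariant_prec_succ x xi eta; rewrite invariant_succ opprD.
by move/(canRL (addrK _)); rewrite opprD !opprK addKr.
Qed.

(** Paired with [zeta], each intertwining condition becomes one of the three invariance identities
    once skew-symmetry moves [Imap r] onto [zeta]. *)
Lemma quasi_triangular_action :
  is_dendriform prec succ ->
  is_action prec succ (prec_plus succ r) (succ_plus prec r)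
    (dualmap (rmul prec + rmul succ)) (- dualmap prec)
    (- dualmap (rmul succ)) (dualmap (prec + succ)).
Proof.
move=> dendA; apply: (@action_of_intertwiner _ _ _ _ _ _ _ _ _ dendA
  (dualmap_representation dendA) _ _ (Imap r)).
- move=> x u; apply: dual_separates => zeta.
  by rewrite Imap_skew dualmap_rmulDE -invariant_succ.
- move=> x u; apply: dual_separates => zeta.
  by rewrite Imap_skew !opp_lfunE opprK dualmapE invariant_prec.
- move=> x u; apply: dual_separates => zeta.
  by rewrite Imap_skew !opp_lfunE opprK dualmapE rmulE -invariant_prec.
- move=> x u; apply: dual_separates => zeta.
  by rewrite Imap_skew dualmapDE invariant_prec_succ opprK.
- by move=> u v; rewrite prec_plusE !opp_lfunE opprK.
(* [succ_plus] acts through [Imap r] of its second argument; invariance trades this for the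
   first. *)
move=> u v; apply/lfunP => y.
by rewrite succ_plusE opp_lfunE dualmapE dualmap_rmulDE invariant_prec_succ opprK.
Qed.

End Invariant.

(** * The D-equation paired with three covectors *)

Section DEquation.
Variables (prec succ : product A).

Lemma rplus_tens n (a b : 'I_n -> A) xi :
  rplus (\sum_i tens (a i) (b i)) xi = \sum_i xi (a i) *: b i.
Proof.
apply: dual_separates => zeta.
rewrite rplusE /teval tlift_sum linear_sum; apply: eq_bigr => i _.
by rewrite -/(teval _ _ _) teval_tens linearZ.
Qed.

Lemma rminus_tens n (a b : 'I_n -> A) xi :
  rminus (\sum_i tens (a i) (b i)) xi = \sum_i xi (b i) *: a i.
Proof.
apply: dual_separates => zeta.
rewrite rminusE /teval tlift_sum linear_sum; apply: eq_bigr => i _.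
by rewrite -/(teval _ _ _) teval_tens linearZ /= mulrC.
Qed.

Definition teval3 xi eta zeta (t : tensor A (tensor A A)) : K^o :=
  tlift (fun x s => xi x * teval s eta zeta : K^o) t.

Lemma teval3_tens xi eta zeta x y z :
  teval3 xi eta zeta (tens x (tens y z)) = xi x * (eta y * zeta z).
Proof.
rewrite /teval3 tliftE ?teval_tens //; split=> [u c v v' | v c u u'].
  by rewrite [teval _ _ _]tlift_linear mulrDr mulrCA.
by rewrite linearP mulrDl -scalerAl.
Qed.

(** In each term of [D_expr] two slots hold a single entry: contracting an [a] produces [rplus],
    contracting a [b] produces [rminus], and the third covector stays on the product. *)
Lemma D_equation_eval r xi eta zeta : D_equation prec succ r ->
  xi (prec (rminus r eta) (rminus r zeta)) + xi (succ (rminus r eta) (rminus r zeta))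
  = zeta (prec (rplus r xi) (rplus r eta)) + eta (succ (rminus r zeta) (rplus r xi)).
Proof.
move=> [n [a [b [-> /(congr1 (teval3 xi eta zeta))]]]].
have bil (m : product A) (c d : 'I_n -> K) (x y : 'I_n -> A) (th : dual K A) :
    th (m (\sum_i c i *: x i) (\sum_j d j *: y j))
    = \sum_i \sum_j c i * (d j * th (m (x i) (y j))).
  rewrite [m (\sum_i _)]linear_sum sum_lfunE linear_sum; apply: eq_bigr => i _.
  rewrite linearZ scale_lfunE linearZ /= !linear_sum; apply: eq_bigr => j _.
  by rewrite !linearZ; apply: mulrCA.
have lin := tlift_linear (fun x s => xi x * teval s eta zeta : K^o).
have teval3B (s t : tensor A (tensor A A)) :
    teval3 xi eta zeta (s - t) = teval3 xi eta zeta s - teval3 xi eta zeta t.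
  have := lin (- 1) t s; rewrite !scaleN1r [- t + s]addrC => E.
  by rewrite /teval3 E addrC.
rewrite !rminus_tens !rplus_tens !bil /D_expr !teval3B.
have sum3 (t : 'I_n -> 'I_n -> tensor A (tensor A A)) :
    teval3 xi eta zeta (\sum_i \sum_j t i j)
    = \sum_i \sum_j teval3 xi eta zeta (t i j).
  rewrite /teval3 tlift_sum; apply: eq_bigr => i _; exact: tlift_sum.
rewrite !sum3 [teval3 _ _ _ 0]tlift0 -addrA -opprD => /eqP.
rewrite subr_eq0 => /eqP D0; rewrite -big_split /=.
transitivity (\sum_i \sum_j teval3 xi eta zeta
  (tens (prec (a i) (a j) + succ (a i) (a j)) (tens (b i) (b j)))).
  apply: eq_bigr => i _; rewrite -big_split; apply: eq_bigr => j _ /=.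
  by rewrite teval3_tens linearD -!mulrDr mulrA mulrC.
rewrite D0; congr (_ + _); apply: eq_bigr => i _; apply: eq_bigr => j _.
  by rewrite teval3_tens.
by rewrite teval3_tens mulrA mulrC.
Qed.

End DEquation.
End Dual.

(** * The two Rota-Baxter identities *)

Theorem theorem3p5 (K : fieldType) (charK : 2%N \notin [pchar K])
    (A : vectType K) (prec succ : product A)
    (dendA : is_dendriform prec succ)
    (r : tensor A A) (qtr : is_quasi_triangular prec succ r) :
  is_relative_rota_baxter 1 prec succ (prec_plus succ r) (succ_plus prec r)
    (dualmap (rmul prec + rmul succ))
    (- dualmap prec)
    (- dualmap (rmul succ))
    (dualmap (prec + succ))
    (rplus r).
Proof.
have [Dr invr] := qtr; split; first exact: quasi_triangular_action.
all: move=> u v; apply: dual_separates => zeta.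
all: have rpE xi : rplus r xi = Imap r xi + rminus r xi.
  1,3: by rewrite add_lfunE opp_lfunE subrK.
all: have rpl (m : product A) (th : dual K A) xi y : th (m (rplus r xi) y) =
       th (m (Imap r xi) y) + th (m (rminus r xi) y).
  1,3: by rewrite rpE linearD add_lfunE linearD.
all: have rpr (m : product A) (th : dual K A) xi y : th (m y (rplus r xi)) =
       th (m y (Imap r xi)) + th (m y (rminus r xi)).
  1,3: by rewrite rpE !linearD.
(* [rminus r] is the transpose of [rplus r], so the right-hand side becomes a covector evaluated at
   [rminus r zeta]. *)
all: rewrite rplusE -rminusE ![(_ + _ : dual K A) _]add_lfunE scale1r.
(* The D-equation is used at [(v, zeta, u)]. By invariance the [Imap r u] part of the [ls] term
   cancels the weight term, and the [Imap r zeta] part of the D-equation supplies the [Imap r u]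
   part of the left-hand side. *)
- rewrite succ_plusE !opp_lfunE dualmap_rmulDE !dualmapE.
  rewrite (rpl _ zeta) 2!(rpr _ v) addrACA (invariant_prec_succ charK invr).
  rewrite (D_equation_eval _ _ _ Dr) (rpr _ u) (invariant_prec charK invr).
  by rewrite [- _ + _]addrC [RHS]addrAC subrK addrAC addrK.
(* Here the D-equation is used at [(u, v, zeta)], and the [Imap r v] part of the [rp] term cancels
   the weight term. *)
rewrite prec_plusE !opp_lfunE dualmapDE !dualmapE !rmulE.
rewrite 2!(rpl _ u) addrACA (D_equation_eval _ _ _ Dr).
rewrite (invariant_succ charK invr) [- _ + _]addrC [RHS]addrAC.
by rewrite [X in X - _ - _]addrC !addrK.
Qed.
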